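(* Let $W$ be an irreducible transition matrix on a finite set $\mathcal X$, let $g:\mathcal X\times\mathcal X\to\mathbb R$ be linearly independent under $W$, and let $\{W_\theta\}_{\theta\in\mathbb R}$ be the one-parameter exponential family of transition matrices generated by $W$ with the generator $g$, with potential function $\phi$ and expectation parameter $\eta(\theta)=\frac{d\phi}{d\theta}(\theta)$. Suppose that $X^{n+1}=(X_{n+1},\dots,X_1)$ is distributed according to $W_\theta^{\times n}\times\overline P^1_\theta$, where $\overline P^1_\theta$ is the stationary distribution of $W_\theta$, and let $g^n(X^{n+1}):=\sum_{k=1}^n g(X_{k+1},X_k)$. Then $\frac{g^n(X^{n+1})}{n}$ is an unbiased estimator of $\eta$, i.e. $\mathsf E_\theta\bigl[\frac{g^n(X^{n+1})}{n}\bigr]=\eta(\theta)$, and for each $\theta$, as $n\to\infty$, $$\mathsf V_\theta\Bigl[\frac{g^n(X^{n+1})}{n}\Bigr]=\frac{\frac{d^2\phi}{d\theta^2}(\theta)}{n}+O\Bigl(\frac1{n\sqrt n}\Bigr).$$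
   Context: A transition matrix on a finite set $\mathcal X$ is a nonnegative matrix $W(x|x')$ with $\sum_x W(x|x')=1$ for every $x'$; $\mathcal X^2_W:=\{(x,x'):W(x|x')>0\}$. It acts on column vectors by $v\mapsto\sum_{x'}W(x|x')v(x')$. $W$ is irreducible if for all $x,x'$ there is $n$ with $W^n(x|x')>0$. A single function $g$ is linearly independent under $W$ if there are no $f:\mathcal X\to\mathbb R$ and $c\in\mathbb R$ with $g(x,x')=f(x)-f(x')+c$ for all $(x,x')\in\mathcal X_W^2$. One-parameter exponential family: for $\theta\in\mathbb R$ let $\overline W_\theta(x|x'):=W(x|x')e^{\theta g(x,x')}$, let $\lambda_\theta$ be its Perron–Frobenius eigenvalue, $\phi(\theta):=\log\lambda_\theta$, and $\overline P^3_\theta$ the positive Perron–Frobenius eigenvector of $\overline W_\theta^T$. Put $W_\theta(x|x'):=\lambda_\theta^{-1}\overline P^3_\theta(x)\overline W_\theta(x|x')\overline P^3_\theta(x')^{-1}$. $W_\theta^{\times n}\times\overline P^1_\theta(x_{n+1},\dots,x_1):=W_\theta(x_{n+1}|x_n)\cdots W_\theta(x_2|x_1)\overline P^1_\theta(x_1)$; $\mathsf E_\theta$ and $\mathsf V_\theta$ denote expectation and variance under this distribution. *)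

(* Defs.v *)
From mathcomp Require Import all_boot all_order all_algebra.
From mathcomp Require Import complex.
From mathcomp Require Import all_classical all_reals all_analysis.
Import Order.TTheory GRing.Theory Num.Theory.
Import numFieldNormedType.Exports.

Set Implicit Arguments.
Unset Strict Implicit.
Unset Printing Implicit Defensive.

Local Open Scope classical_set_scope.
Local Open Scope ring_scope.

(* Throughout, a matrix indexed by the finite set X is a function
   A : X -> X -> R with A x x' standing for A(x|x'): the first argument is the
   row (next state), the second one the column (current state). *)

Section TransitionMatrices.
Variables (R : realType) (X : finType).
Implicit Types (A W g : X -> X -> R) (v : X -> R) (t : R).

Definition mx_of A : 'M[R]_#|X| :=
  \matrix_(i, j) A (enum_val i) (enum_val j).

Definition transition_matrix W : Prop :=
  (forall x x', 0 <= W x x') /\ (forall x', \sum_x W x x' = 1).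

Definition irreducible_matrix A : Prop :=
  forall x x', exists n : nat,
    0 < (mx_of A ^+ n) (enum_rank x) (enum_rank x').

Definition lin_indep_under W g : Prop :=
  ~ exists (f : X -> R) (c : R),
      forall x x', 0 < W x x' -> g x x' = f x - f x' + c.

(* The Perron-Frobenius eigenvalue, i.e. the spectral radius: the largest
   modulus of a complex eigenvalue.  [eigenvalue] refers to row eigenvectors,
   but a square matrix and its transpose have the same eigenvalues. *)
Definition PF_eigenvalue A : R :=
  sup [set Normc.normc z | z in
        [set z : R[i] | eigenvalue (map_mx (real_complex R) (mx_of A)) z]].

(* v is a positive Perron-Frobenius eigenvector of the transpose of A; for an
   irreducible nonnegative A it is unique up to a positive factor. *)
Definition PF_left_eigenvector A v : Prop :=
  (forall x, 0 < v x) /\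
  (forall x', \sum_x A x x' * v x = PF_eigenvalue A * v x').

Definition tilted W g t : X -> X -> R :=
  fun x x' => W x x' * expR (t * g x x').

Definition potential W g : R -> R :=
  fun t => ln (PF_eigenvalue (tilted W g t)).

(* The member W_t of the exponential family, built from a Perron-Frobenius
   left eigenvector v of [tilted W g t]; rescaling v does not change it. *)
Definition exp_family W g t v : X -> X -> R :=
  fun x x' => (PF_eigenvalue (tilted W g t))^-1 * v x * tilted W g t x x' *
              (v x')^-1.

Definition stationary_distribution W v : Prop :=
  [/\ forall x, 0 <= v x,
      \sum_x v x = 1 &
      forall x, \sum_x' W x x' * v x' = v x].

(* A trajectory (X_1, ..., X_(n+1)) is x : {ffun 'I_n.+1 -> X}, where x i is
   X_(i+1).  For k : 'I_n, [lift ord0 k] has value k.+1 and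
   [widen_ord (leqnSn n) k] has value k. *)
Definition path_prob W v (n : nat) (x : {ffun 'I_n.+1 -> X}) : R :=
  (\prod_(k < n) W (x (lift ord0 k)) (x (widen_ord (leqnSn n) k))) *
  v (x ord0).

Definition path_sum g (n : nat) (x : {ffun 'I_n.+1 -> X}) : R :=
  \sum_(k < n) g (x (lift ord0 k)) (x (widen_ord (leqnSn n) k)).

End TransitionMatrices.

Arguments path_prob {R X} W v n x.

Section FiniteProbability.
Variables (R : realType) (T : finType).

(* Expectation and variance of f under the probability mass function p. *)
Definition pmf_expectation (p f : T -> R) : R := \sum_x p x * f x.

Definition pmf_variance (p f : T -> R) : R :=
  pmf_expectation p (fun x => (f x - pmf_expectation p f) ^+ 2).

End FiniteProbability.

(* Main.v *)
Require Import Defs.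
From mathcomp Require Import all_boot all_order all_algebra.
From mathcomp Require Import all_classical all_reals all_analysis.
From mathcomp Require Import ring lra.
Import Order.TTheory GRing.Theory Num.Theory.
Import numFieldNormedType.Exports.

Set Implicit Arguments.
Unset Strict Implicit.
Unset Printing Implicit Defensive.

Local Open Scope classical_set_scope.
Local Open Scope ring_scope.

(** Fix t and let K = W_t, P its stationary distribution, v_s the left
    Perron-Frobenius eigenvector of the matrix tilted by s.  Then W_(t+h) is K
    tilted by h, with eigenvector ratio r_h = v_(t+h) / v_t and eigenvalue
    ratio rho_h.  Normalise r_h by sum P r_h = 1.  As w |-> K^T w - w - <P, w>
    is invertible, the eigenvalue equation of r_h gives r_h -> 1, then
    (rho_h - 1) / h -> eta = E[g] and (r_h - 1) / h -> psi, where
    m(x, x') = g(x, x') + psi(x) - psi(x') - eta, the derivative of log W_t,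
    has conditional mean 0.  Since the two marginals of the stationary pair law
    agree, eta(t+h) - eta(t) is the mean of m under W_(t+h), which yields
    eta' = E[m^2].  Finally g^n - n eta is the martingale sum of the m's, of
    variance n E[m^2], up to a boundary term bounded uniformly in n; the cross
    term is of order sqrt n.  No mixing is used, so periodicity is harmless. *)

(** * Limits of finite sums and of products with a bounded factor *)

Lemma cvg_sumr (R : realType) (I : finType) (T : Type) (F : set_system T)
    {FF : Filter F} (f : I -> T -> R) (l : I -> R) :
  (forall i, f i x @[x --> F] --> l i) ->
  (\sum_i f i x) @[x --> F] --> \sum_i l i.
Proof.
move=> fl; apply: (@cvg_big R) => //.
exact: pseudometric_normed_Zmodule.add_continuous.
Qed.

(** Used where one factor is not yet known to converge: the ratios [r h x] and the laws [Q h x] are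
    at first only bounded. *)
Lemma cvg0_mul_bounded (R : realType) (T : Type) (F : set_system T)
    {FF : Filter F} (e b : T -> R) (B : R) :
  (forall x, `|b x| <= B) -> e x @[x --> F] --> 0 ->
  (e x * b x) @[x --> F] --> 0.
Proof.
move=> bB e0; apply/norm_cvg0P; have {}e0 := (norm_cvg0P e).2 e0.
apply: (@squeeze_cvgr _ _ _ _ (fun=> 0) (fun x => `|e x| * B)).
- by apply: filterE => x; rewrite normr_ge0 normrM ler_wpM2l.
- exact: cvg_cst.
- rewrite -[X in _ --> X](mul0r B).
  apply: (@cvgM R T F FF (fun x => `|e x|) (fun=> B)); first exact: e0.
  exact: (@cvg_cst R).
Qed.

(** * Irreducible chains, stationary laws and the Poisson equation *)

Section IrreducibleChain.
Variables (R : realType) (X : finType).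
Implicit Types (A K M N : X -> X -> R) (P w f : X -> R).

(* Irreducibility without matrix powers: only the support of [K] matters. *)
Definition closed_total K : Prop :=
  forall (S : pred X) x, S x ->
    (forall y z, S z -> 0 < K y z -> S y) -> forall y, S y.

(** A positive entry of the power m+1 has a nonzero term in its expansion, so its last step follows
    the support of [K]; by induction [S] contains every state reachable from [x]. *)
Lemma irreducible_closed_total K : (forall x x', 0 <= K x x') ->
  irreducible_matrix K -> closed_total K.
Proof.
move=> K0 irr S x Sx cl y; have [n] := irr y x.
suff step m i j : S (enum_val i) -> 0 < (mx_of K ^+ m) j i -> S (enum_val j).
  by rewrite -[y in S y]enum_rankK; apply: step; rewrite enum_rankK.
move=> Si; elim: m j => [|m IH] j.
  by rewrite expr0 mxE; case: eqP => [->//|_]; rewrite ltxx.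
rewrite exprS mxE => /lt0r_neq0 s0.
have [k nz] : exists k, mx_of K j k * (mx_of K ^+ m) k i != 0.
  apply/existsP; apply: contraNT s0 => /existsPn z.
  by rewrite big1 // => k _; apply/eqP; move: (z k); rewrite negbK.
have pn a b : 0 <= (mx_of K ^+ m) a b.
  elim: (m) a b => [|p IHp] a b; first by rewrite expr0 mxE ler0n.
  by rewrite exprS mxE sumr_ge0 // => c _; rewrite mulr_ge0 // mxE.
apply: (cl _ (enum_val k)).
  apply: IH; rewrite lt_neqAle pn andbT eq_sym.
  by apply: contraNneq nz => ->; rewrite mulr0.
rewrite lt_neqAle K0 andbT eq_sym; apply: contraNneq nz.
by rewrite [mx_of K j k]mxE => ->; rewrite mul0r.
Qed.

Lemma closed_total_support K K' : (forall x x', 0 < K x x' -> 0 < K' x x') ->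
  closed_total K -> closed_total K'.
Proof.
move=> KK' tot S x Sx cl; apply: (tot S x) => // y z Sz /KK'; exact: cl.
Qed.

(** Maximum principle: at a maximiser the nonnegative gaps to the maximum average to 0, so every
    successor is again a maximiser. *)
Lemma harmonic_constant K f : transition_matrix K -> closed_total K ->
  (forall x', \sum_x K x x' * f x = f x') -> forall x y, f x = f y.
Proof.
move=> [K0 K1] tot fh x y.
pose z := [arg max_(i > x) f i]%O.
have zmax i : f i <= f z by rewrite /z; case: arg_maxP => // j _; apply.
suff fz u : f u = f z by rewrite !fz.
apply/eqP; apply: (tot (fun u => f u == f z) z) => // a b /eqP fb Kab.
have: \sum_c K c b * (f z - f c) = 0.
  under eq_bigr do rewrite mulrBr.
  by rewrite sumrB -mulr_suml K1 fh fb mul1r subrr.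
move/eqP; rewrite psumr_eq0; last by move=> c _; rewrite mulr_ge0 // subr_ge0.
move=> /allP /(_ a (mem_index_enum _)); rewrite mulf_eq0 gt_eqF //=.
by rewrite subr_eq0 eq_sym.
Qed.

(** The support of [P] is nonempty, having mass 1, and closed under the transitions of [K]. *)
Lemma stationary_gt0 K P : transition_matrix K -> closed_total K ->
  stationary_distribution K P -> forall x, 0 < P x.
Proof.
move=> [K0 K1] tot [P0 P1 PK] x.
have [y Py] : exists y, 0 < P y.
  apply/existsP; apply: contraT => /existsPn z.
  have : \sum_y P y = 0.
    by apply: big1 => y _; apply/eqP; rewrite eq_le P0 andbT leNgt.
  by rewrite P1 => /eqP; rewrite oner_eq0.
apply: (tot (fun u => 0 < P u) y) => // a b Pb Kab.
rewrite -PK; apply: lt_le_trans (_ : K a b * P b <= _); first exact: mulr_gt0.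
by rewrite (bigD1 b) //= lerDl sumr_ge0 // => c _; rewrite mulr_ge0.
Qed.

Lemma stationary_sum K P f : transition_matrix K ->
  stationary_distribution K P ->
  \sum_x' P x' * \sum_x K x x' * f x = \sum_x P x * f x.
Proof.
move=> [K0 K1] [P0 P1 PK].
under eq_bigr do rewrite mulr_sumr.
rewrite exchange_big /=; apply: eq_bigr => x _.
rewrite -[in RHS]PK mulr_suml; apply: eq_bigr => x' _; ring.
Qed.

(** Matrix inversion carried over to functions on [X]; the transpose turns the kernel hypothesis
    into one on row vectors, the side that [kermx] describes. *)
Lemma injective_inverse M :
  (forall w, (forall y, \sum_z M y z * w z = 0) -> forall x, w x = 0) ->
  exists N, (forall x y, \sum_z N x z * M z y = (x == y)%:R) /\
            (forall x y, \sum_z M x z * N z y = (x == y)%:R).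
Proof.
move=> Minj; pose A := (mx_of M)^T.
have sumE (F : X -> R) : \sum_z F z = \sum_(i < #|X|) F (enum_val i).
  by rewrite (reindex _ (onW_bij _ (enum_val_bij X))).
have Au : A \in unitmx.
  rewrite -row_free_unit -kermx_eq0; apply/eqP/row_matrixP => i; rewrite row0.
  set u := row i _.
  have uA : u *m A = 0 by rewrite -row_mul mulmx_ker row0.
  have w0 := Minj (fun x => u 0 (enum_rank x)).
  apply/rowP => j; rewrite [RHS]mxE -[j]enum_valK; apply: w0 => y.
  move/rowP/(_ (enum_rank y)): uA; rewrite !mxE => uA; rewrite -[RHS]uA sumE.
  by apply: eq_bigr => k _; rewrite !mxE enum_rankK enum_valK mulrC.
pose B := (invmx A)^T; exists (fun x y => B (enum_rank x) (enum_rank y)).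
have AE x y : A (enum_rank y) (enum_rank x) = M x y by rewrite !mxE !enum_rankK.
have dE x y : (1%:M : 'M[R]_#|X|) (enum_rank y) (enum_rank x) = (x == y)%:R.
  by rewrite mxE (inj_eq enum_rank_inj) eq_sym.
split=> x y; rewrite -dE.
  rewrite -(mulmxV Au) mxE sumE; apply: eq_bigr => k _.
  by rewrite !mxE !enum_rankK enum_valK mulrC.
rewrite -(mulVmx Au) mxE sumE; apply: eq_bigr => k _.
by rewrite !mxE !enum_rankK enum_valK mulrC.
Qed.

(* Subtracting the rank-one term [sum_z P z w z] removes the constants from
   the kernel of [K^T - 1]. *)
Lemma poisson_inverse K P : transition_matrix K -> closed_total K ->
  stationary_distribution K P ->
  exists N,
    [/\ forall w x,
          w x = \sum_y N x y * (\sum_z K z y * w z - w y - \sum_z P z * w z),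
        forall b y, let w x := \sum_z N x z * b z in
          \sum_z K z y * w z - w y - \sum_z P z * w z = b y &
        forall w x,
          w x = \sum_y N y x * (\sum_z K y z * w z - w y - P y * \sum_z w z)].
Proof.
move=> Ktr Ktot KP; have [K0 K1] := Ktr; have [P0 P1 PK] := KP.
pose M y z := K z y - (z == y)%:R - P z.
have dl (w : X -> R) y : \sum_z (z == y)%:R * w z = w y.
  rewrite (bigD1 y) //= eqxx mul1r big1 ?addr0 // => z /negbTE ->.
  by rewrite mul0r.
have dr (w : X -> R) y : \sum_z (y == z)%:R * w z = w y.
  by rewrite -[RHS]dl; apply: eq_bigr => z _; rewrite eq_sym.
have ME w y :
    \sum_z M y z * w z = \sum_z K z y * w z - w y - \sum_z P z * w z.
  by rewrite -[w y in RHS]dl -!sumrB; apply: eq_bigr => z _; rewrite /M; ring.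
have MTE w y :
    \sum_z M z y * w z = \sum_z K y z * w z - w y - P y * \sum_z w z.
  rewrite -[w y in RHS]dr mulr_sumr -!sumrB.
  by apply: eq_bigr => z _; rewrite /M; ring.
have [|N [NM MN]] := @injective_inverse M.
  move=> w Mw.
  (* Pairing with [P] cancels the first two terms by stationarity and leaves -<P, w>. Then [w] is
     harmonic, hence constant and equal to its mean 0. *)
  have Pw : \sum_z P z * w z = 0.
    have: \sum_y P y * (\sum_z M y z * w z) = 0.
      by apply: big1 => y _; rewrite Mw mulr0.
    under eq_bigr do rewrite ME !mulrBr.
    rewrite !sumrB stationary_sum // subrr -mulr_suml P1 mul1r sub0r.
    by move/eqP; rewrite oppr_eq0 => /eqP.
  have wc := @harmonic_constant K w Ktr Ktot.
  move=> x; rewrite -Pw -[LHS]mul1r -P1 mulr_suml.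
  apply: eq_bigr => z _; congr (_ * _); apply: wc => y.
  by move/eqP: (Mw y); rewrite ME Pw subr0 subr_eq0 => /eqP.
have assoc (U V : X -> X -> R) w x :
    \sum_y U x y * (\sum_z V y z * w z) = \sum_z (\sum_y U x y * V y z) * w z.
  under eq_bigr do rewrite mulr_sumr.
  rewrite exchange_big; apply: eq_bigr => z _; rewrite mulr_suml.
  by apply: eq_bigr => y _; rewrite mulrA.
exists N; split.
- move=> w x; under eq_bigr do rewrite -ME.
  by rewrite assoc; under eq_bigr do rewrite NM; rewrite dr.
- move=> b y w; rewrite -ME /w assoc.
  by under eq_bigr do rewrite MN; rewrite dr.
(* The transposed inverse inverts the transposed matrix; this form serves for laws, through
   [Q h - P]. *)
- move=> w x; under eq_bigr do rewrite -MTE.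
  rewrite (assoc (fun x y => N y x) (fun y z => M z y)) -[LHS]dl.
  apply: eq_bigr => z _; congr (_ * _); rewrite -MN.
  by apply: eq_bigr => y _; rewrite mulrC.
Qed.

End IrreducibleChain.

(** * Difference quotients at 0 *)

Lemma cvg_eq_lim (R : realType) (T : Type) (F : set_system T) (f : T -> R)
    (l l' : R) :
  l = l' -> f x @[x --> F] --> l -> f x @[x --> F] --> l'.
Proof. by move=> ->. Qed.

Lemma cvg_dnbhs0_eq (R : realType) (f f' : R -> R) (l : R) :
  (forall h, h != 0 -> f h = f' h) ->
  f' h @[h --> 0^'] --> l -> f h @[h --> 0^'] --> l.
Proof.
move=> ff'; apply: cvg_trans; apply: near_eq_cvg; near=> h.
by apply/esym/ff'; near: h; exact: nbhs_dnbhs_neq.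
Unshelve. all: by end_near. Qed.

Lemma is_derive_slopeP (R : realType) (f : R -> R) (t d : R) :
  (h^-1 * (f (t + h) - f t)) @[h --> 0^'] --> d <-> is_derive t 1 f d.
Proof.
have E : (fun h : R => h^-1 *: ((f \o shift t) (h *: 1) - f t)) =
         (fun h => h^-1 * (f (t + h) - f t)).
  by apply/funext => h /=; rewrite [h *: 1]mulr1 [h + t]addrC.
split=> [fd|[fd <-]].
  apply: DeriveDef; first by apply/cvg_ex; exists d; rewrite E.
  by rewrite /derive E; apply: cvg_lim.
by rewrite -E; exact: fd.
Qed.

Lemma cvg_expR_slope (R : realType) (c : R) :
  (h^-1 * (expR (h * c) - 1)) @[h --> 0^'] --> c.
Proof.
have D : is_derive (0 : R) 1 (fun h => expR (h * c)) c.
  have -> : (fun h : R => expR (h * c)) = expR \o (fun h => h * c) by [].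
  rewrite -[X in is_derive _ _ _ X]mul1r; apply: is_derive1_comp.
    by rewrite mul0r -[X in is_derive _ _ _ X]expR0; exact: is_derive_expR.
  apply/is_derive_slopeP; apply: (@cvg_dnbhs0_eq _ _ (fun=> c)).
    by move=> h h0; rewrite add0r mul0r subr0 mulKf.
  exact: cvg_cst.
move/is_derive_slopeP: D; rewrite mul0r expR0.
by under eq_fun do rewrite add0r.
Qed.

(** * First-order perturbation of the Perron-Frobenius data and of the stationary law *)

(* In the application [K] is [W_t], [r h] and [rho h] are the ratios of the
   Perron-Frobenius data at [t + h] and [t], and [L h] is [W_(t+h)]. *)
Section Perturbation.
Variables (R : realType) (X : finType).
Variables (K g : X -> X -> R) (P : X -> R).
Variables (r : R -> X -> R) (rho : R -> R) (Q : R -> X -> R).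
Hypothesis Ktr : transition_matrix K.
Hypothesis Ktot : closed_total K.
Hypothesis KP : stationary_distribution K P.
Hypothesis r_gt0 : forall h x, 0 < r h x.
Hypothesis rho_gt0 : forall h, 0 < rho h.
Hypothesis eig : forall h x',
  \sum_x K x x' * expR (h * g x x') * r h x = rho h * r h x'.
Hypothesis r_norm : forall h, \sum_x P x * r h x = 1.
Let L h x x' := (rho h)^-1 * r h x * (K x x' * expR (h * g x x')) / r h x'.
Hypothesis LQ : forall h, stationary_distribution (L h) (Q h).
Let eta := \sum_x' P x' * \sum_x K x x' * g x x'.

(** [G] and [d] are the difference quotients of the tilt and of the eigenvector ratio; [b] is the
    right-hand side of the Poisson equation that [d] solves. *)
Let G x x' (h : R) := h^-1 * (expR (h * g x x') - 1).
Let b (h : R) x' :=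
  h^-1 * (rho h - 1) * r h x' - \sum_x K x x' * (G x x' h * r h x).
Let d (h : R) x := h^-1 * (r h x - 1).

Let Gcvg x x' : G x x' h @[h --> 0^'] --> g x x'.
Proof. exact: cvg_expR_slope. Qed.

Let idc : (fun h : R => h) @ 0^' --> (0 : R).
Proof. exact: cvg_within. Qed.

Let cvg_hmul (f : R -> R) (l : R) :
  f h @[h --> 0^'] --> l -> (h * f h) @[h --> 0^'] --> (0 : R).
Proof. by move=> fl; apply: (cvg_eq_lim (mul0r l)); apply: cvgM. Qed.

(** The terms of the normalising sum are positive and add up to 1, so [r h x] is at most the inverse
    of [P x]. *)
Let r_bound x : exists B : R, forall h, `|r h x| <= B.
Proof.
have P_gt0 := stationary_gt0 Ktr Ktot KP.
exists (P x)^-1 => h; rewrite gtr0_norm // -[leRHS]mul1r ler_pdivlMr //.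
rewrite -(r_norm h) (bigD1 x) //= mulrC lerDl sumr_ge0 // => y _.
by rewrite mulr_ge0 // ltW.
Qed.

(** Pair the eigenvalue equation with [P]: by stationarity and normalisation the slope of [rho]
    involves [r] but no difference quotient of [r]. *)
Let rhoE (h : R) : h != 0 ->
  h^-1 * (rho h - 1) = \sum_x' P x' * \sum_x K x x' * (G x x' h * r h x).
Proof.
move=> h0; have [K0 K1] := Ktr; have [P0 P1 PK] := KP.
apply: (@mulfI _ h) => //; rewrite mulVKf // mulr_sumr.
have -> : rho h = \sum_x' P x' * (rho h * r h x').
  by rewrite -[LHS]mulr1 -(r_norm h) mulr_sumr; apply: eq_bigr => x _; ring.
have -> : 1 = \sum_x' P x' * \sum_x K x x' * r h x.
  by rewrite stationary_sum.
rewrite -sumrB; apply: eq_bigr => x' _; rewrite -eig -mulrBr -sumrB.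
rewrite !mulr_sumr; apply: eq_bigr => x _.
rewrite /G; field; exact: h0.
Qed.

(** The normalisation makes <P, d> vanish, so the eigenvalue equation takes exactly the form
    inverted by [poisson_inverse]. *)
Let slopeE (h : R) x' : h != 0 ->
  \sum_x K x x' * d h x - d h x' - \sum_x P x * d h x = b h x'.
Proof.
move=> h0; have [K0 K1] := Ktr; have [P0 P1 PK] := KP.
have -> : \sum_x P x * d h x = 0.
  rewrite /d; under eq_bigr do rewrite mulrCA mulrBr mulr1.
  by rewrite -mulr_sumr sumrB r_norm P1 subrr mulr0.
rewrite subr0 /b /d; apply: (@mulfI _ h) => //.
transitivity (\sum_x K x x' * r h x - r h x').
  rewrite mulrBr mulVKf // mulr_sumr.
  under eq_bigr do rewrite mulrCA mulVKf // mulrBr mulr1.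
  by rewrite sumrB K1; ring.
rewrite mulrBr -[_ * _ * r h x']mulrA mulVKf // mulrBl mul1r -eig addrAC.
rewrite mulr_sumr -sumrB; congr (_ - _); apply: eq_bigr => x _.
by rewrite /G; field.
Qed.

Lemma perturbation_cvg : exists psi : X -> R,
  let m x x' := g x x' + psi x - psi x' - eta in
  [/\ h^-1 * (rho h - 1) @[h --> 0^'] --> eta,
      forall x', \sum_x K x x' * m x x' = 0 &
      h^-1 * (\sum_x' Q h x' * (\sum_x L h x x' * g x x') - eta) @[h --> 0^']
        --> \sum_x' P x' * \sum_x K x x' * m x x' ^+ 2].
Proof.
have [K0 K1] := Ktr; have [P0 P1 PK] := KP.
have [N [N1 N2 N3]] := poisson_inverse Ktr Ktot KP.
(* After multiplying [rhoE] by [h], each term contains [h * G], which tends to 0, times a bounded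
   ratio; [r_cvg] repeats this after applying [N]. *)
have rho_cvg : rho h @[h --> 0^'] --> (1 : R).
  apply: (@cvg_dnbhs0_eq _ _ (fun h => 1 + \sum_x' P x' *
      \sum_x K x x' * (h * G x x' h * r h x))).
    move=> h h0.
    rewrite -[rho h](subrK 1) addrC; congr (_ + _).
    rewrite -[LHS](mulVKf h0) rhoE // mulr_sumr; apply: eq_bigr => x' _.
    rewrite mulrCA; congr (_ * _); rewrite mulr_sumr.
    by apply: eq_bigr => x _; ring.
  apply: (cvg_eq_lim (addr0 _)); apply: cvgD; first exact: cvg_cst.
  apply: (@cvg_eq_lim _ _ _ _ (\sum_(x' : X) P x' * \sum_(x : X) K x x' * 0)).
    by rewrite big1 // => x' _; rewrite big1 ?mulr0 // => x _; exact: mulr0.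
  apply: cvg_sumr => x'; apply: cvgM; first exact: cvg_cst.
  apply: cvg_sumr => x; apply: cvgM; first exact: cvg_cst.
  have [B rB] := r_bound x; apply: (cvg0_mul_bounded rB).
  by apply: cvg_hmul; exact: Gcvg.
have r_cvg x : r h x @[h --> 0^'] --> (1 : R).
  apply: (@cvg_dnbhs0_eq _ _ (fun h => 1 + \sum_y N x y *
      ((rho h - 1) * r h y - \sum_z K z y * (h * G z y h * r h z)))).
    move=> h h0.
    rewrite -[r h x](subrK 1) addrC; congr (_ + _).
    rewrite -[LHS](mulVKf h0) -/(d h x) [in LHS]N1 mulr_sumr.
    apply: eq_bigr => y _; rewrite slopeE // mulrCA; congr (_ * _).
    rewrite /b mulrBr !mulrA divff // mul1r; congr (_ - _).
    rewrite mulr_sumr; apply: eq_bigr => z _; ring.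
  apply: (cvg_eq_lim (addr0 _)); apply: cvgD; first exact: cvg_cst.
  apply: (@cvg_eq_lim _ _ _ _ (\sum_(y : X) N x y *
      (0 - \sum_(z : X) K z y * 0))).
    rewrite big1 // => y _; rewrite big1 ?subrr ?mulr0 // => z _.
    exact: mulr0.
  apply: cvg_sumr => y; apply: cvgM; first exact: cvg_cst.
  apply: cvgB.
    have [B rB] := r_bound y; apply: (cvg0_mul_bounded rB).
    by apply: (cvg_eq_lim (subrr 1)); apply: cvgB; [|exact: cvg_cst].
  apply: cvg_sumr => z; apply: cvgM; first exact: cvg_cst.
  have [B rB] := r_bound z; apply: (cvg0_mul_bounded rB).
  by apply: cvg_hmul; exact: Gcvg.
have Gr_cvg x' : (\sum_x K x x' * (G x x' h * r h x)) @[h --> 0^'] -->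
    \sum_x K x x' * g x x'.
  apply: cvg_sumr => x; apply: cvgM; first exact: cvg_cst.
  by apply: (cvg_eq_lim (mulr1 _)); apply: cvgM.
have rho_slope : h^-1 * (rho h - 1) @[h --> 0^'] --> eta.
  apply: (@cvg_dnbhs0_eq _ _ (fun h => \sum_x' P x' *
      \sum_x K x x' * (G x x' h * r h x))).
    by move=> h h0; rewrite rhoE.
  by apply: cvg_sumr => x'; apply: cvgM; first exact: cvg_cst.
pose b0 y := eta - \sum_x K x y * g x y.
have b_cvg y : b h y @[h --> 0^'] --> b0 y.
  by apply: cvgB => //; apply: (cvg_eq_lim (mulr1 _)); apply: cvgM.
(* Since [d] is [N] applied to [b], its limit is [N] applied to the limit [b0]. *)
pose psi x := \sum_y N x y * b0 y.
have d_cvg x : d h x @[h --> 0^'] --> psi x.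
  apply: (@cvg_dnbhs0_eq _ _ (fun h => \sum_y N x y * b h y)).
    by move=> h h0; rewrite [LHS]N1; apply: eq_bigr => y _; rewrite slopeE.
  by apply: cvg_sumr => y; apply: cvgM; first exact: cvg_cst.
(* The right-hand side [b0] has mean 0 under [P], so the rank-one correction drops out and [psi]
   solves the genuine Poisson equation, which is [m0]. *)
have Ppsi : \sum_x P x * psi x = 0.
  have : \sum_y P y * (\sum_z K z y * psi z - psi y - \sum_z P z * psi z) = 0.
    under eq_bigr do rewrite N2.
    under eq_bigr do rewrite mulrBr.
    by rewrite sumrB -/eta -mulr_suml P1 mul1r subrr.
  under eq_bigr do rewrite !mulrBr.
  rewrite !sumrB stationary_sum // subrr -mulr_suml P1 mul1r sub0r.
  by move/eqP; rewrite oppr_eq0 => /eqP.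
exists psi => m.
have m0 x' : \sum_x K x x' * m x x' = 0.
  rewrite /m; under eq_bigr do rewrite !mulrBr mulrDr.
  rewrite !sumrB big_split /= -!mulr_suml K1 !mul1r.
  have := N2 b0 x' :
    \sum_z K z x' * psi z - psi x' - \sum_z P z * psi z = b0 x'.
  by rewrite Ppsi /b0; lra.
split=> //.
(* The density of [L h] with respect to [K]; its slope at 0 is [m]. *)
pose E h x x' := (rho h)^-1 * r h x * expR (h * g x x') / r h x'.
have LE h x x' : L h x x' = K x x' * E h x x' by rewrite /L /E; ring.
have slope_E x x' : h^-1 * (E h x x' - 1) @[h --> 0^'] --> m x x'.
  apply: (@cvg_dnbhs0_eq _ _ (fun h => (G x x' h * r h x + d h x -
      h^-1 * (rho h - 1) * r h x' - d h x') * (rho h * r h x')^-1)).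
    move=> h h0.
    rewrite /E /G /d; field.
    by rewrite h0 !gt_eqF.
  have -> : m x x' = (g x x' * 1 + psi x - eta * 1 - psi x') * (1 * 1)^-1.
    by rewrite /m !mulr1 invr1; ring.
  apply: cvgM.
    by apply: cvgB => //; apply: cvgB; [apply: cvgD => //|]; apply: cvgM.
  by apply: cvgV; [rewrite mulr1 oner_neq0|apply: cvgM].
have E_cvg x x' : E h x x' @[h --> 0^'] --> (1 : R).
  apply: (@cvg_dnbhs0_eq _ _ (fun h => 1 + h * (h^-1 * (E h x x' - 1)))).
    move=> h h0.
    by rewrite mulVKf // addrC subrK.
  apply: (cvg_eq_lim (addr0 _)); apply: cvgD; first exact: cvg_cst.
  by apply: cvg_hmul; exact: slope_E.
have Qb x h : `|Q h x| <= 1.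
  have [Q0 Q1 _] := LQ h.
  by rewrite ger0_norm // -Q1 (bigD1 x) //= lerDl sumr_ge0.
(* [Q h - P] has total mass 0, and its defect under [K] is [K] applied to (1 - E) Q, a vanishing
   factor times a bounded one. *)
have Q_cvg x : Q h x @[h --> 0^'] --> P x.
  have -> : Q^~ x = (fun h => P x +
      \sum_y N y x * \sum_z K y z * ((1 - E h y z) * Q h z)).
    apply/funext => h; rewrite -[LHS](subrK (P x)) addrC; congr (_ + _).
    rewrite [LHS](N3 (fun x => Q h x - P x)); apply: eq_bigr => y _.
    congr (_ * _).
    have [Q0 Q1 LQh] := LQ h.
    rewrite sumrB Q1 P1 subrr mulr0 subr0.
    under eq_bigr do rewrite mulrBr.
    rewrite sumrB PK -[X in _ - (X - _)]LQh opprB addrA subrK -sumrB.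
    by apply: eq_bigr => z _; rewrite LE; ring.
  apply: (cvg_eq_lim (addr0 _)); apply: cvgD; first exact: cvg_cst.
  apply: (@cvg_eq_lim _ _ _ _ (\sum_(y : X) N y x * \sum_(z : X) K y z * 0)).
    by rewrite big1 // => y _; rewrite big1 ?mulr0 // => z _; exact: mulr0.
  apply: cvg_sumr => y; apply: cvgM; first exact: cvg_cst.
  apply: cvg_sumr => z; apply: cvgM; first exact: cvg_cst.
  apply: (cvg0_mul_bounded (Qb z)).
  by apply: (cvg_eq_lim (subrr 1)); apply: cvgB; first exact: cvg_cst.
apply: (@cvg_dnbhs0_eq _ _ (fun h => \sum_x' Q h x' *
    \sum_x K x x' * (h^-1 * (E h x x' - 1) * m x x'))).
  move=> h h0.
  have [Q0 Q1 LQh] := LQ h.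
  have Ltr : transition_matrix (L h).
    split=> [x x'|x'].
      by rewrite /L !mulr_ge0 ?invr_ge0 ?expR_ge0 // ltW.
    transitivity ((rho h * r h x')^-1 *
        \sum_x K x x' * expR (h * g x x') * r h x).
      rewrite mulr_sumr; apply: eq_bigr => x _; rewrite /L invfM; ring.
    by rewrite eig mulVf // mulf_neq0 // gt_eqF.
  apply: (@mulfI _ h) => //; rewrite mulVKf // mulr_sumr.
  (* The mean of [m] under the perturbed pair law is the increment of the mean of [g], the [psi]
     terms cancelling by stationarity. Subtracting [m0] replaces the density [E] by [E - 1], of
     order [h]. *)
  transitivity (\sum_x' Q h x' * \sum_x L h x x' * m x x'); last first.
    apply: eq_bigr => x' _; rewrite [RHS]mulrCA; congr (_ * _).
    rewrite -[LHS]subr0 -[X in _ - X](m0 x') -sumrB mulr_sumr.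
    by apply: eq_bigr => x _; rewrite LE; field.
  have -> : \sum_x' Q h x' * \sum_x L h x x' * m x x' =
    \sum_x' (Q h x' * (\sum_x L h x x' * g x x') +
      Q h x' * (\sum_x L h x x' * psi x) - Q h x' * psi x' - Q h x' * eta).
    apply: eq_bigr => x' _; rewrite -mulrDr -!mulrBr; congr (_ * _).
    under eq_bigr do rewrite !mulrBr mulrDr.
    have L1 c : \sum_x L h x x' * c = c.
      by rewrite -[RHS]mul1r -(Ltr.2 x') mulr_suml.
    by rewrite !sumrB big_split /= !L1.
  rewrite !sumrB big_split /= (stationary_sum _ Ltr (LQ h)) -mulr_suml Q1 mul1r.
  ring.
apply: cvg_sumr => x'; apply: cvgM => //.
apply: cvg_sumr => x; apply: cvgM; first exact: cvg_cst.
rewrite expr2; apply: cvgM => //; exact: cvg_cst.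
Qed.

End Perturbation.

(** * Linearity and monotonicity of finite expectations *)

Section FiniteExpectation.
Variables (R : realType) (T : finType).
Implicit Types (p f : T -> R).

Lemma pmf_expectationD p f f' :
  pmf_expectation p (fun x => f x + f' x) =
  pmf_expectation p f + pmf_expectation p f'.
Proof.
by rewrite /pmf_expectation -big_split; apply: eq_bigr => x _; rewrite mulrDr.
Qed.

Lemma pmf_expectationZ p (c : R) f :
  pmf_expectation p (fun x => c * f x) = c * pmf_expectation p f.
Proof.
by rewrite /pmf_expectation mulr_sumr; apply: eq_bigr => x _; rewrite mulrCA.
Qed.

Lemma ler_pmf_expectation p f f' : (forall x, 0 <= p x) ->
  (forall x, f x <= f' x) -> pmf_expectation p f <= pmf_expectation p f'.
Proof. by move=> p0 ff'; apply: ler_sum => x _; rewrite ler_wpM2l. Qed.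

Lemma eq_pmf_expectation p f f' :
  f =1 f' -> pmf_expectation p f = pmf_expectation p f'.
Proof. by move=> ff'; apply: eq_bigr => x _; rewrite ff'. Qed.

End FiniteExpectation.

(** * Trajectories: one-step conditioning and moments of additive functionals *)

Section Paths.
Variables (R : realType) (X : finType).
Implicit Types (K g m : X -> X -> R) (P f : X -> R).

(** The new state comes last in time, so that induction on [n] amounts to conditioning on the
    past. *)
Definition path_snoc n (x : {ffun 'I_n.+1 -> X}) (y : X) :
    {ffun 'I_n.+2 -> X} :=
  [ffun i => if unlift ord_max i is Some j then x j else y].

Lemma path_snoc_max n (x : {ffun 'I_n.+1 -> X}) y : path_snoc x y ord_max = y.
Proof. by rewrite ffunE unlift_none. Qed.

Lemma path_snoc_widen n (x : {ffun 'I_n.+1 -> X}) y (i : 'I_n.+2)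
    (j : 'I_n.+1) :
  i = j :> nat -> path_snoc x y i = x j.
Proof.
move=> ij; rewrite ffunE; have -> : i = lift ord_max j.
  by apply: val_inj; rewrite /= /bump leqNgt ltn_ord.
by rewrite liftK.
Qed.

Lemma sum_path_snoc n (F : {ffun 'I_n.+2 -> X} -> R) :
  \sum_x F x = \sum_x \sum_y F (path_snoc x y).
Proof.
rewrite pair_bigA /= (reindex (fun p => path_snoc p.1 p.2)) //=.
exists (fun x : {ffun 'I_n.+2 -> X} =>
  ([ffun j => x (lift ord_max j)] : {ffun 'I_n.+1 -> X}, x ord_max)).
- move=> [x y] _ /=; rewrite path_snoc_max; congr (_, _).
  by apply/ffunP => j; rewrite !ffunE liftK.
- move=> x _ /=; apply/ffunP => i; rewrite ffunE /=.
  by case: unliftP => [j ->|->] //; rewrite ffunE.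
Qed.

Lemma path_sum_snoc g n (x : {ffun 'I_n.+1 -> X}) y :
  path_sum g (path_snoc x y) = path_sum g x + g y (x ord_max).
Proof.
rewrite /path_sum big_ord_recr /=; congr (_ + _).
  by apply: eq_bigr => k _; congr (g _ _); apply: path_snoc_widen.
congr (g _ _); last exact: path_snoc_widen.
by rewrite -[RHS](path_snoc_max x); congr (path_snoc _ _ _); apply: val_inj.
Qed.

Lemma path_prob_snoc K P n (x : {ffun 'I_n.+1 -> X}) y :
  path_prob K P n.+1 (path_snoc x y) = path_prob K P n x * K y (x ord_max).
Proof.
rewrite /path_prob big_ord_recr /= [RHS]mulrAC; congr (_ * _).
  congr (_ * _).
    by apply: eq_bigr => k _; congr (K _ _); apply: path_snoc_widen.
  congr (K _ _); last exact: path_snoc_widen.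
  by rewrite -[RHS](path_snoc_max x); congr (path_snoc _ _ _); apply: val_inj.
by congr (P _); apply: path_snoc_widen.
Qed.

(** Tower property: the inner sum is the conditional expectation given the first n+1 states. *)
Lemma path_expectation_snoc K P n (F : {ffun 'I_n.+2 -> X} -> R) :
  pmf_expectation (path_prob K P n.+1) F =
  pmf_expectation (path_prob K P n)
    (fun x => \sum_y K y (x ord_max) * F (path_snoc x y)).
Proof.
rewrite /pmf_expectation sum_path_snoc; apply: eq_bigr => x _.
by rewrite mulr_sumr; apply: eq_bigr => y _; rewrite path_prob_snoc mulrA.
Qed.

Lemma path_expectation0 K P (F : {ffun 'I_1 -> X} -> R) :
  pmf_expectation (path_prob K P 0) F = \sum_y P y * F [ffun=> y].
Proof.
rewrite /pmf_expectation.
rewrite (reindex (fun y : X => [ffun=> y] : {ffun 'I_1 -> X})) /=.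
  by apply: eq_bigr => y _; rewrite /path_prob big_ord0 mul1r ffunE.
exists (fun x : {ffun 'I_1 -> X} => x ord0) => [y _|x _].
  by rewrite ffunE.
by apply/ffunP => i; rewrite ffunE [i]ord1.
Qed.

Lemma path_sum0 g (x : {ffun 'I_1 -> X}) : path_sum g x = 0.
Proof. exact: big_ord0. Qed.

(** Peel the first, then the last, term off the same sum over all n+1 states and compare. *)
Lemma path_sum_telescope f n (x : {ffun 'I_n.+1 -> X}) :
  path_sum (fun y y' => f y - f y') x = f (x ord_max) - f (x ord0).
Proof.
have e : \sum_(i < n.+1) f (x i) =
    f (x ord0) + \sum_(k < n) f (x (lift ord0 k)).
  exact: big_ord_recl.
have e' : \sum_(i < n.+1) f (x i) =
    \sum_(k < n) f (x (widen_ord (leqnSn n) k)) + f (x ord_max).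
  exact: big_ord_recr.
rewrite /path_sum sumrB; lra.
Qed.

Lemma path_sumD g g' n (x : {ffun 'I_n.+1 -> X}) :
  path_sum (fun y y' => g y y' + g' y y') x = path_sum g x + path_sum g' x.
Proof. exact: big_split. Qed.

Lemma path_sum_cst (c : R) n (x : {ffun 'I_n.+1 -> X}) :
  path_sum (fun _ _ => c) x = n%:R * c.
Proof. by rewrite /path_sum sumr_const card_ord mulr_natl. Qed.

Section Stationary.
Variables (K : X -> X -> R) (P : X -> R).
Hypotheses (Ktr : transition_matrix K) (KP : stationary_distribution K P).
Local Notation "'E_ n" := (pmf_expectation (path_prob K P n))
  (at level 8, n at level 2).

Lemma path_prob_ge0 n (x : {ffun 'I_n.+1 -> X}) : 0 <= path_prob K P n x.
Proof.
have [K0 _] := Ktr; have [P0 _ _] := KP.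
by rewrite mulr_ge0 // prodr_ge0.
Qed.

Lemma path_expectation_last n f :
  'E_n (fun x => f (x ord_max)) = \sum_y P y * f y.
Proof.
elim: n f => [|n IH] f.
  by rewrite path_expectation0; apply: eq_bigr => y _; rewrite ffunE.
rewrite path_expectation_snoc -(stationary_sum _ Ktr KP) -IH.
apply: eq_pmf_expectation => x; apply: eq_bigr => y _.
by rewrite path_snoc_max.
Qed.

Lemma path_expectation_cst n (c : R) : 'E_n (fun=> c) = c.
Proof.
have [_ P1 _] := KP.
by rewrite (path_expectation_last n (fun=> c)) -mulr_suml P1 mul1r.
Qed.

Lemma path_expectation_sum g n :
  'E_n (fun x => path_sum g x) = n%:R * \sum_y P y * \sum_x K x y * g x y.
Proof.
have [K0 K1] := Ktr.
elim: n => [|n IH].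
  rewrite path_expectation0 mul0r big1 // => y _.
  by rewrite path_sum0 mulr0.
rewrite path_expectation_snoc.
under eq_pmf_expectation => x.
  under eq_bigr do rewrite path_sum_snoc mulrDr.
  rewrite big_split /= -mulr_suml K1 mul1r.
over.
rewrite pmf_expectationD IH.
rewrite (path_expectation_last n (fun y => \sum_x K x y * g x y)).
by rewrite -natr1 mulrDl mul1r.
Qed.

(** The increments are orthogonal: given the past, the cross term has mean 0 by [m0], and by
    stationarity each step adds the same second moment. *)
Lemma path_expectation_martingale_sqr m n :
  (forall x', \sum_x K x x' * m x x' = 0) ->
  'E_n (fun x => path_sum m x ^+ 2) =
  n%:R * \sum_y P y * \sum_x K x y * m x y ^+ 2.
Proof.
have [K0 K1] := Ktr => m0.
elim: n => [|n IH].
  rewrite path_expectation0 mul0r big1 // => y _.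
  by rewrite path_sum0 expr0n mulr0.
rewrite path_expectation_snoc.
under eq_pmf_expectation => x.
  under eq_bigr => y _.
    rewrite path_sum_snoc.
    rewrite (_ : _ * _ ^+ 2 = K y (x ord_max) * path_sum m x ^+ 2
      + 2 * path_sum m x * (K y (x ord_max) * m y (x ord_max))
      + K y (x ord_max) * m y (x ord_max) ^+ 2); last by ring.
  over.
  rewrite !big_split /= -mulr_suml K1 mul1r -mulr_sumr m0 mulr0 addr0.
over.
rewrite pmf_expectationD IH.
rewrite (path_expectation_last n (fun y => \sum_x K x y * m x y ^+ 2)).
by rewrite -natr1 mulrDl mul1r.
Qed.

(* The boundary terms are bounded, and [2 |S D| <= S^2 / s + s D^2] with
   [s = sqrt n] controls their product with the martingale part [S]. *)
Lemma path_variance_poisson g psi (eta : R) n :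
  let m x x' := g x x' + psi x - psi x' - eta in
  let sigma2 := \sum_y P y * \sum_x K x y * m x y ^+ 2 in
  let C := (\sum_x `|psi x|) *+ 2 in
  (forall x', \sum_x K x x' * m x x' = 0) ->
  `|'E_n (fun x => (path_sum g x - n%:R * eta) ^+ 2) - n%:R * sigma2| <=
  Num.sqrt n%:R * (sigma2 + C ^+ 2 *+ 2).
Proof.
move=> m sigma2 C m0.
have [n0|n_gt0] := posnP n.
  subst n; rewrite path_expectation0 big1; last first.
    by move=> y _; rewrite path_sum0 mul0r subrr expr0n mulr0.
  by rewrite mul0r subrr normr0 sqrtr0 mul0r.
set s := Num.sqrt _.
have s2 : s ^+ 2 = n%:R by rewrite sqr_sqrtr.
(* In the upper bound this absorbs the square of [D] into [s] times it, whence the factor 2 on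
   [C ^+ 2]. *)
have s1 : 1 <= s.
  by rewrite -[leLHS]sqrtr1 ler_sqrt ?ler1n // ltr0n.
have s0 : 0 < s by apply: lt_le_trans s1.
pose D (x : {ffun 'I_n.+1 -> X}) := psi (x ord0) - psi (x ord_max).
have psiC x : `|psi x| <= \sum_x `|psi x|.
  by rewrite [leRHS](bigD1 x) //= lerDl sumr_ge0.
have C0 : 0 <= C by rewrite mulrn_wge0 // sumr_ge0.
have DC x : `|D x| <= C.
  by apply: le_trans (ler_normB _ _) _; rewrite /C mulr2n lerD.
have D2 x : D x ^+ 2 <= C ^+ 2.
  by rewrite -[D x ^+ 2]real_normK ?num_real // ler_sqr ?nnegrE ?DC.
(* The [psi] part of [m] telescopes, so the centred sum is a martingale plus the boundary term
   [D]. *)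
have dec x : path_sum g x - n%:R * eta = path_sum m x + D x.
  have -> : path_sum m x =
      path_sum g x + (psi (x ord_max) - psi (x ord0)) + n%:R * - eta.
    rewrite -(path_sum_telescope psi x) -(path_sum_cst (- eta) x) -!path_sumD.
    by apply: eq_bigr => k _; rewrite /m; ring.
  by rewrite /D; ring.
under eq_pmf_expectation do rewrite dec.
have ub (x : {ffun 'I_n.+1 -> X}) : (path_sum m x + D x) ^+ 2 <=
    (1 + s^-1) * path_sum m x ^+ 2 + (s * C ^+ 2 *+ 2).
  have : 0 <= s^-1 * (path_sum m x - s * D x) ^+ 2.
    by rewrite mulr_ge0 ?sqr_ge0 // invr_ge0 ltW.
  have -> : s^-1 * (path_sum m x - s * D x) ^+ 2 =
    s^-1 * path_sum m x ^+ 2 - 2 * path_sum m x * D x + s * D x ^+ 2.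
    by field; rewrite gt_eqF.
  have := D2 x; have := sqr_ge0 (D x); nra.
have lb (x : {ffun 'I_n.+1 -> X}) :
    (1 - s^-1) * path_sum m x ^+ 2 + - (s * C ^+ 2 *+ 2) <=
    (path_sum m x + D x) ^+ 2.
  have : 0 <= s^-1 * (path_sum m x + s * D x) ^+ 2.
    by rewrite mulr_ge0 ?sqr_ge0 // invr_ge0 ltW.
  have -> : s^-1 * (path_sum m x + s * D x) ^+ 2 =
    s^-1 * path_sum m x ^+ 2 + 2 * path_sum m x * D x + s * D x ^+ 2.
    by field; rewrite gt_eqF.
  have := D2 x; have := sqr_ge0 (D x); nra.
have := ler_pmf_expectation (@path_prob_ge0 n) ub.
have := ler_pmf_expectation (@path_prob_ge0 n) lb.
rewrite !pmf_expectationD !pmf_expectationZ !path_expectation_cst.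
rewrite path_expectation_martingale_sqr // -/sigma2 -s2.
rewrite mulrBl mulrDl !mul1r.
rewrite (_ : s^-1 * (s ^+ 2 * sigma2) = s * sigma2); last first.
  by rewrite expr2 -mulrA mulKf ?gt_eqF.
move=> l u; rewrite ler_norml; apply/andP; split; lra.
Qed.

End Stationary.
End Paths.

(** * The exponential family and the derivatives of its potential *)

Section ExponentialFamily.
Variables (R : realType) (X : finType) (W g : X -> X -> R).
Hypothesis W_transition : transition_matrix W.

(** Evaluate the eigenvector equation at [x0]: the column of [W] there sums to 1, hence has a
    positive entry. *)
Lemma PF_eigenvalue_tilted_gt0 t v (x0 : X) :
  PF_left_eigenvector (tilted W g t) v -> 0 < PF_eigenvalue (tilted W g t).
Proof.
have [W0 W1] := W_transition; move=> [v0 ev].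
rewrite -(pmulr_lgt0 _ (v0 x0)) -ev lt_neqAle eq_sym psumr_neq0; last first.
  by move=> x _; rewrite !mulr_ge0 ?expR_ge0 // ltW.
rewrite sumr_ge0 => [|x _]; last by rewrite !mulr_ge0 ?expR_ge0 // ltW.
have [//||x /= Wx] := @psumr_neq0P _ _ xpredT (W^~ x0).
  by rewrite W1; apply/eqP; rewrite oner_neq0.
rewrite andbT; apply/hasP; exists x; first exact: mem_index_enum.
by rewrite /= !mulr_gt0 ?expR_gt0.
Qed.

Lemma exp_family_transition t v : PF_left_eigenvector (tilted W g t) v ->
  transition_matrix (exp_family W g t v).
Proof.
have [W0 W1] := W_transition; move=> pf; have [v0 ev] := pf; split=> [x x'|x'].
  have l0 := PF_eigenvalue_tilted_gt0 x pf.
  by rewrite !mulr_ge0 ?invr_ge0 ?expR_ge0 // ltW.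
have l0 := PF_eigenvalue_tilted_gt0 x' pf.
rewrite /exp_family.
transitivity ((PF_eigenvalue (tilted W g t) * v x')^-1 *
  \sum_x tilted W g t x x' * v x).
  rewrite mulr_sumr; apply: eq_bigr => x _; rewrite invfM; ring.
by rewrite ev mulVf // mulf_neq0 // gt_eqF.
Qed.

Lemma exp_family_closed_total t v : irreducible_matrix W ->
  PF_left_eigenvector (tilted W g t) v -> closed_total (exp_family W g t v).
Proof.
have [W0 W1] := W_transition; move=> Wirr pf; have [v0 ev] := pf.
apply: closed_total_support (irreducible_closed_total W0 Wirr) => x x' Wx.
have l0 := PF_eigenvalue_tilted_gt0 x pf.
by rewrite !mulr_gt0 ?invr_gt0 ?expR_gt0.
Qed.

Variables P1 P3 : R -> X -> R.
Hypothesis W_irreducible : irreducible_matrix W.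
Hypothesis P3_PF : forall t : R, PF_left_eigenvector (tilted W g t) (P3 t).
Hypothesis P1_stationary : forall t : R,
  stationary_distribution (exp_family W g t (P3 t)) (P1 t).

(** The explicit form of eta as a stationary mean, identified below with the derivative of the
    potential. *)
Definition expectation_parameter t : R :=
  \sum_x' P1 t x' * \sum_x exp_family W g t (P3 t) x x' * g x x'.

Lemma exp_family_derivatives t : exists psi : X -> R,
  let K := exp_family W g t (P3 t) in
  let m x x' := g x x' + psi x - psi x' - expectation_parameter t in
  [/\ is_derive t 1 (potential W g) (expectation_parameter t),
      forall x', \sum_x K x x' * m x x' = 0 &
      is_derive t 1 expectation_parameter
        (\sum_x' P1 t x' * \sum_x K x x' * m x x' ^+ 2)].
Proof.
pose K := exp_family W g t (P3 t).
(* The existential makes [lam] opaque, hiding the supremum that defines the eigenvalue. *)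
have [lam lamE] : exists lam, forall s, PF_eigenvalue (tilted W g s) = lam s.
  by exists (fun s => PF_eigenvalue (tilted W g s)).
have [P0 Psum _] := P1_stationary t.
have [x0 _] : exists x0 : X, true.
  apply/existsP; apply: contraT => /existsPn e.
  move: Psum; rewrite big1 => [/eqP|x]; last by have := e x.
  by rewrite eq_sym oner_eq0.
have lam0 s : 0 < lam s.
  by rewrite -lamE; exact: PF_eigenvalue_tilted_gt0 x0 (P3_PF s).
have v0 s x : 0 < P3 s x by have [] := P3_PF s.
have Ktr := exp_family_transition (P3_PF t).
have Ktot := exp_family_closed_total W_irreducible (P3_PF t).
have Pgt0 := stationary_gt0 Ktr Ktot (P1_stationary t).
(* Each [P3 s] is fixed only up to a positive factor; dividing by [c h] selects the scale for which
   [r h] has mean 1 under [P1 t]. *)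
pose c h := \sum_x P1 t x * (P3 (t + h) x / P3 t x).
have c0 h : 0 < c h.
  rewrite /c (bigD1 x0) //= ltr_wpDr ?mulr_gt0 ?divr_gt0 ?invr_gt0 //.
  by rewrite sumr_ge0 //; move=> x _; rewrite mulr_ge0 ?divr_ge0 // ltW.
pose r h x := (c h)^-1 * (P3 (t + h) x / P3 t x).
pose rho h := lam (t + h) / lam t.
have r_gt0 h x : 0 < r h x by rewrite /r !mulr_gt0 ?invr_gt0.
have rho_gt0 h : 0 < rho h by rewrite divr_gt0.
have tiltD h x x' : W x x' * expR ((t + h) * g x x') =
    W x x' * expR (t * g x x') * expR (h * g x x').
  by rewrite mulrDl expRD mulrA.
have eig h x' : \sum_x K x x' * expR (h * g x x') * r h x = rho h * r h x'.
  have [_ ev] := P3_PF (t + h).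
  transitivity ((c h * lam t * P3 t x')^-1 *
      \sum_x tilted W g (t + h) x x' * P3 (t + h) x).
    rewrite mulr_sumr; apply: eq_bigr => x _.
    rewrite /r /K /exp_family lamE {2}/tilted tiltD /tilted.
    by field; rewrite !gt_eqF.
  by rewrite ev lamE /rho /r; field; rewrite !gt_eqF.
have r_norm h : \sum_x P1 t x * r h x = 1.
  rewrite /r; under eq_bigr do rewrite mulrCA.
  by rewrite -mulr_sumr mulVf // gt_eqF.
have LE h : exp_family W g (t + h) (P3 (t + h)) =
    (fun x x' => (rho h)^-1 * r h x * (K x x' * expR (h * g x x')) / r h x').
  apply/funext => x; apply/funext => x'.
  rewrite /K /exp_family /rho /r !lamE {1}/tilted tiltD /tilted.
  by field; rewrite !gt_eqF.
have LQ h : stationary_distribution (fun x x' => (rho h)^-1 * r h x *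
    (K x x' * expR (h * g x x')) / r h x') (P1 (t + h)).
  by rewrite -LE; exact: P1_stationary.
have [psi [drho m0 deta]] :=
  perturbation_cvg Ktr Ktot (P1_stationary t) r_gt0 rho_gt0 eig r_norm LQ.
exists psi; split => //.
- have dlam : is_derive t 1 lam (lam t * expectation_parameter t).
    apply/is_derive_slopeP.
    apply: (@cvg_dnbhs0_eq _ _ (fun h => lam t * (h^-1 * (rho h - 1)))).
      by move=> h h0; rewrite /rho; field; rewrite h0 gt_eqF.
    by apply: cvgM; first exact: cvg_cst.
  have -> : potential W g = @ln R \o lam.
    by apply/funext => s; rewrite /potential lamE.
  have <- : (lam t)^-1 * (lam t * expectation_parameter t) =
      expectation_parameter t by rewrite mulKf // gt_eqF.
  by apply: is_derive1_comp; exact: is_derive1_ln.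
- apply/is_derive_slopeP; apply: cvg_dnbhs0_eq deta => h _.
  by rewrite /expectation_parameter LE.
Qed.

End ExponentialFamily.

(** * Unbiasedness and the variance expansion *)

Theorem mainTheorem6 (R : realType) (X : finType) (W g : X -> X -> R)
    (P1 P3 : R -> X -> R)
    (W_transition : transition_matrix W)
    (W_irreducible : irreducible_matrix W)
    (g_indep : lin_indep_under W g)
    (P3_PF : forall t : R, PF_left_eigenvector (tilted W g t) (P3 t))
    (P1_stationary : forall t : R,
        stationary_distribution (exp_family W g t (P3 t)) (P1 t)) :
  let phi := potential W g in
  let eta := (phi^`())%classic in
  let E := fun (t : R) (n : nat) (f : {ffun 'I_n.+1 -> X} -> R) =>
    pmf_expectation (path_prob (exp_family W g t (P3 t)) (P1 t) n) f in
  let V := fun (t : R) (n : nat) (f : {ffun 'I_n.+1 -> X} -> R) =>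
    pmf_variance (path_prob (exp_family W g t (P3 t)) (P1 t) n) f in
  [/\ (forall t : R, derivable phi t 1 /\ derivable eta t 1),
      (forall (t : R) (n : nat), (0 < n)%N ->
        E t n (fun x => path_sum g x / n%:R) = eta t) &
      (forall t : R,
        (fun n : nat => V t n (fun x => path_sum g x / n%:R)
                        - (phi^`(2))%classic t / n%:R : R^o)
        =O_\oo (fun n : nat => (n%:R * Num.sqrt n%:R)^-1 : R^o))].
Proof.
move=> phi eta E V.
have der t := exp_family_derivatives W_transition W_irreducible P3_PF
  P1_stationary t.
have etaE : eta = expectation_parameter W g P1 P3.
  apply/funext => t; have [psi [dphi _ _]] := der t.
  by rewrite /eta derive1E derive_val.
have unbiased t n : (0 < n)%N ->
    E t n (fun x => path_sum g x / n%:R) = eta t.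
  move=> n0; have Ktr := exp_family_transition W_transition (P3_PF t).
  rewrite /E; under eq_pmf_expectation do rewrite mulrC.
  rewrite pmf_expectationZ path_expectation_sum // etaE mulKf //.
  by rewrite pnatr_eq0 -lt0n.
split=> [t||t] //.
  by have [psi [dphi _ deta]] := der t; split; rewrite ?etaE; apply: ex_derive.
have [psi [dphi m0 deta]] := der t.
have Ktr := exp_family_transition W_transition (P3_PF t).
have bound n := path_variance_poisson Ktr (P1_stationary t) n m0.
move: deta bound; set s2 := \sum_x' _; set B := s2 + _ => deta bound.
have phi2 : (phi^`(2))%classic t = s2.
  by rewrite -[LHS]/((eta^`())%classic t) etaE derive1E derive_val.
have s2_ge0 : 0 <= s2.
  have [K0 _] := Ktr; have [P0 _ _] := P1_stationary t.
  rewrite sumr_ge0 // => y _; rewrite mulr_ge0 // sumr_ge0 // => x _.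
  by rewrite mulr_ge0 ?sqr_ge0.
have B_ge0 : 0 <= B by rewrite addr_ge0 // mulrn_wge0 // sqr_ge0.
(* The constant has to be positive, and [B] is only known to be nonnegative. *)
apply/eqO_exP; exists (B + 1); first by rewrite ltr_wpDl.
near=> n.
have n_gt0 : (0 < n)%N by near: n; exact: nbhs_infty_gt.
have nR : 0 < n%:R :> R by rewrite ltr0n.
(* By unbiasedness the variance is centred at eta, so the bound on the unnormalised sum applies
   after scaling by the inverse square of [n]. *)
have -> : V t n (fun x => path_sum g x / n%:R) =
    n%:R ^- 2 * E t n (fun x => (path_sum g x - n%:R * eta t) ^+ 2).
  rewrite /E -pmf_expectationZ; apply: eq_pmf_expectation => x.
  rewrite -[pmf_expectation _ _]/(E t n _) unbiased //.
  by field; rewrite gt_eqF.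
rewrite phi2 (_ : _ - _ = n%:R ^- 2 *
  (E t n (fun x => (path_sum g x - n%:R * eta t) ^+ 2) - n%:R * s2));
  last first.
  by field; rewrite gt_eqF.
have s_gt0 : 0 < Num.sqrt n%:R :> R by rewrite sqrtr_gt0.
rewrite normrM [`|_ ^- 2|]gtr0_norm ?invr_gt0 ?exprn_gt0 //.
rewrite [`|_^-1|]gtr0_norm ?invr_gt0 ?mulr_gt0 //.
apply: (@le_trans _ _ (n%:R ^- 2 * (Num.sqrt n%:R * B))).
  rewrite ler_wpM2l ?invr_ge0 ?exprn_ge0 // etaE; exact: bound.
have -> : n%:R ^- 2 * (Num.sqrt n%:R * B) = B * (n%:R * Num.sqrt n%:R)^-1.
  have sq : Num.sqrt n%:R ^+ 2 = n%:R :> R by rewrite sqr_sqrtr // ltW.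
  by rewrite -sq sqrtr_sqr gtr0_norm //; field; rewrite gt_eqF.
by rewrite ler_wpM2r ?lerDl // invr_ge0 mulr_ge0 // ltW.
Unshelve. all: by end_near. Qed.
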